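(* There exist universal constants $0<c_1\le c_2$ such that the following holds. Let $0<\mu_x\le L_x$, $0<\mu_y\le L_y$, $L_{xy}\ge 0$, and let $f\in\mathcal F(\mu_x,\mu_y,L_x,L_y,L_{xy})$. Then there exists a pair of step sizes $\alpha,\beta>0$ with $$\alpha\mu_x=\beta\mu_y,\qquad \frac{c_1}{\kappa_x+\kappa_y+\kappa_{xy}^2}\le \alpha\mu_x\le\frac{c_2}{\kappa_x+\kappa_y+\kappa_{xy}^2},$$ such that, for every initialization $(x_0,y_0)$, the iterates of Sim-GDA with step sizes $\alpha,\beta$ satisfy $\Psi^{\mathrm{Sim}}_{k+1}\le r\,\Psi^{\mathrm{Sim}}_k$ for all $k\ge 0$, where $$r=\left(\frac{\left(\kappa_{xy}+\sqrt{\max\{\kappa_x,\kappa_y\}+\kappa_{xy}^2}\right)^2-1}{\left(\kappa_{xy}+\sqrt{\max\{\kappa_x,\kappa_y\}+\kappa_{xy}^2}\right)^2+1}\right)^2 .$$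
   Context: Function class. For $0<\mu_x\le L_x$, $0<\mu_y\le L_y$, $L_{xy}\ge0$, $\mathcal F(\mu_x,\mu_y,L_x,L_y,L_{xy})$ is the set of all twice-differentiable $f:\mathbb R^{d_x}\times\mathbb R^{d_y}\to\mathbb R$ (any $d_x,d_y$) such that: (i) $f(\cdot,y)$ is $\mu_x$-strongly convex for every $y$ and $f(x,\cdot)$ is $\mu_y$-strongly concave for every $x$ ($g$ is $\mu$-strongly convex if $g(z')\ge g(z)+\langle\nabla g(z),z'-z\rangle+\frac\mu2\|z'-z\|^2$ for all $z,z'$; $g$ is $\mu$-strongly concave if $-g$ is $\mu$-strongly convex); (ii) for all $x,x',y,y'$: $\|\nabla_xf(x',y)-\nabla_xf(x,y)\|\le L_x\|x'-x\|$, $\|\nabla_yf(x,y')-\nabla_yf(x,y)\|\le L_y\|y'-y\|$, $\|\nabla_xf(x,y')-\nabla_xf(x,y)\|\le L_{xy}\|y'-y\|$, $\|\nabla_yf(x',y)-\nabla_yf(x,y)\|\le L_{xy}\|x'-x\|$. Norms are Euclidean. Every such $f$ has a unique Nash equilibrium $z_\star=(x_\star,y_\star)$, i.e. a point with $f(x_\star,y)\le f(x_\star,y_\star)\le f(x,y_\star)$ for all $x,y$. Condition numbers: $\kappa_x=L_x/\mu_x$, $\kappa_y=L_y/\mu_y$, $\kappa_{xy}=L_{xy}/\sqrt{\mu_x\mu_y}$. Sim-GDA with constant step sizes $\alpha,\beta>0$: $x_{k+1}=x_k-\alpha\nabla_xf(x_k,y_k)$, $y_{k+1}=y_k+\beta\nabla_yf(x_k,y_k)$,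 from $(x_0,y_0)$. Lyapunov function: $\Psi^{\mathrm{Sim}}_k=\frac1\alpha\|x_k-x_\star\|^2+\frac1\beta\|y_k-y_\star\|^2$. *)

(* Defs.v *)
From mathcomp Require Import all_boot all_order all_algebra.
From mathcomp Require Import all_classical all_reals all_analysis.

Set Implicit Arguments.
Unset Strict Implicit.
Unset Printing Implicit Defensive.

Import Order.TTheory GRing.Theory Num.Theory.
Import numFieldNormedType.Exports.

Local Open Scope ring_scope.

Definition dotv (R : realType) (n : nat) (u v : 'rV[R]_n) : R :=
  \sum_(i < n) u 0 i * v 0 i.

(* The library's norm `|v| on 'rV[R]_n is the max norm; it is equivalent to
   this one, so [differentiable] below has its usual meaning. *)
Definition enorm (R : realType) (n : nat) (v : 'rV[R]_n) : R :=
  Num.sqrt (dotv v v).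

Definition grad (R : realType) (n : nat) (g : 'rV[R]_n -> R) (x : 'rV[R]_n)
  : 'rV[R]_n := \row_(i < n) 'D_(delta_mx 0 i) g x.

Definition strongly_convex (R : realType) (n : nat) (mu : R)
    (g : 'rV[R]_n -> R) : Prop :=
  forall z z' : 'rV[R]_n,
    g z' >= g z + dotv (grad g z) (z' - z) + mu / 2 * enorm (z' - z) ^+ 2.

Definition strongly_concave (R : realType) (n : nat) (mu : R)
    (g : 'rV[R]_n -> R) : Prop :=
  strongly_convex mu (fun z => - g z).

Section MinMax.
Variables (R : realType) (dx dy : nat).
Implicit Types (f : 'rV[R]_dx * 'rV[R]_dy -> R) (z : 'rV[R]_dx * 'rV[R]_dy).

Definition gradx f z : 'rV[R]_dx := grad (fun x => f (x, z.2)) z.1.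
Definition grady f z : 'rV[R]_dy := grad (fun y => f (z.1, y)) z.2.

Definition twice_differentiable f : Prop :=
  (forall z, differentiable f z) /\
  (forall z, differentiable (gradx f) z /\ differentiable (grady f) z).

Record in_class (mux muy Lx Ly Lxy : R) f : Prop := InClass {
  class_diff2 : twice_differentiable f;
  class_convex : forall y, strongly_convex mux (fun x => f (x, y));
  class_concave : forall x, strongly_concave muy (fun y => f (x, y));
  class_lip_xx : forall x x' y,
    enorm (gradx f (x', y) - gradx f (x, y)) <= Lx * enorm (x' - x);
  class_lip_yy : forall x y y',
    enorm (grady f (x, y') - grady f (x, y)) <= Ly * enorm (y' - y);
  class_lip_xy : forall x y y',
    enorm (gradx f (x, y') - gradx f (x, y)) <= Lxy * enorm (y' - y);
  class_lip_yx : forall x x' y,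
    enorm (grady f (x', y) - grady f (x, y)) <= Lxy * enorm (x' - x)
}.

Definition nash_equilibrium f z : Prop :=
  forall x y, f (z.1, y) <= f z /\ f z <= f (x, z.2).

Definition sim_gda_step (alpha beta : R) f z : 'rV[R]_dx * 'rV[R]_dy :=
  (z.1 - alpha *: gradx f z, z.2 + beta *: grady f z).

Definition sim_gda (alpha beta : R) f (z0 : 'rV[R]_dx * 'rV[R]_dy) (k : nat)
  : 'rV[R]_dx * 'rV[R]_dy := iter k (sim_gda_step alpha beta f) z0.

Definition psi_sim (alpha beta : R) (zs z : 'rV[R]_dx * 'rV[R]_dy) : R :=
  1 / alpha * enorm (z.1 - zs.1) ^+ 2 + 1 / beta * enorm (z.2 - zs.2) ^+ 2.

End MinMax.

Definition sim_gda_rate (R : realType) (kx ky kxy : R) : R :=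
  let s := (kxy + Num.sqrt (Num.max kx ky + kxy ^+ 2)) ^+ 2 in
  ((s - 1) / (s + 1)) ^+ 2.

(* Main.v *)
Require Import Defs.
From mathcomp Require Import all_boot all_order all_algebra.
From mathcomp Require Import all_classical all_reals all_analysis.
From mathcomp Require Import ring lra.

(* Along the segment from the equilibrium [zs] to [z], the mean value theorem
   applied to the scalar function <w, T(.)>, where T is the Sim-GDA step and
   w = T z - zs, replaces the Jacobian of T by its value at one point, which is
   I - M with M = [[A, B], [-B^T, C]] in the norm |x|^2/alpha + |y|^2/beta.
   Here eta <= A, C <= eta K and ||B|| <= eta k with eta = alpha mux,
   K = max(kx, ky), k = kxy. Polarizing with P = d + w and Q = d - w,
     4 <w, (I - M) d> <= (1 - eta)|P|^2 - (1 - eta K)|Q|^2 + 2 eta k |P||Q|,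
   so ||I - M|| is at most the top eigenvalue of
   [[1 - eta, eta k], [eta k, eta K - 1]]. It is minimized, with value
   (p^2 - 1)/(p^2 + 1), at eta = 2 p / (q (p^2 + 1)), where
   q = sqrt (K + k^2) and p = k + q. *)

Set Implicit Arguments.
Unset Strict Implicit.
Unset Printing Implicit Defensive.

Import Order.TTheory GRing.Theory Num.Theory.
Import numFieldNormedType.Exports.

Local Open Scope ring_scope.

(** * Directional derivatives: mean value theorem, bounds by difference quotients, symmetry of
    second derivatives *)

Section Calculus.
Variables (R : realType) (V : normedModType R).
Implicit Types (h : V -> R) (z d u v : V).

Lemma is_derive_line h z d (t : R) : differentiable h (z + t *: d) ->
  is_derive t 1 (fun s : R => h (z + s *: d)) ('D_d h (z + t *: d)).
Proof.
move=> dh.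
have dl : is_diff t (fun s : R => z + s *: d) (fun s : R => s *: d).
  have -> : (fun s : R => z + s *: d) = cst z + ( *:%R ^~ d) by [].
  by apply: is_diff_eq; rewrite add0r.
have [dg dgE] := dl.
have dc : differentiable (h \o (fun s : R => z + s *: d)) t.
  by exact: differentiable_comp.
apply: DeriveDef.
  exact: diff_derivable.
have -> : (fun s : R => h (z + s *: d)) = h \o (fun s : R => z + s *: d) by [].
by rewrite deriveE // diff_comp //= dgE scale1r deriveE.
Qed.

Lemma line_MVT h z d : (forall x, differentiable h x) ->
  exists2 c : R, 0 <= c <= 1 & h (z + d) - h z = 'D_d h (z + c *: d).
Proof.
move=> dh.
have dl (t : R) := is_derive_line (dh (z + t *: d)).
have lc : {within `[(0 : R), 1], continuous (fun s : R => h (z + s *: d))}%classic.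
  apply: derivable_within_continuous => t _.
  by apply: ex_derive; exact: dl.
have [c c01] := MVT_segment ler01 (fun t _ => dl t) lc.
rewrite scale0r addr0 scale1r subr0 mulr1 => ->.
by exists c => //; rewrite in_itv in c01.
Qed.

Lemma derive_le h z d (c : R) : derivable h z d ->
  (forall t : R, t != 0 -> t^-1 * (h (t *: d + z) - h z) <= c) -> 'D_d h z <= c.
Proof.
move=> dh hc; rewrite /derive; apply: limr_le => //.
by apply: filterS (nbhs_dnbhs_neq (0 : R)) => t t0; exact: hc.
Qed.

(** Multiplying the increment by [t] and comparing with [t ^+ 2] makes one hypothesis serve both
    signs of [t]. This is the shape in which strong monotonicity and Lipschitz estimates of a
    gradient arrive. *)
Lemma derive_bounds h z d (a b : R) :
  derivable h z d ->
  (forall t : R, a * t ^+ 2 <= t * (h (t *: d + z) - h z) <= b * t ^+ 2) ->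
  a <= 'D_d h z <= b.
Proof.
move=> dh hab.
have q (t x : R) : t != 0 -> t^-1 * x = (t * x) / t ^+ 2 by move=> t0; field.
apply/andP; split; last first.
  apply: derive_le => // t t0; rewrite q// ler_pdivrMr ?exprn_even_gt0//.
  by case/andP: (hab t).
rewrite -[a]opprK lerNl -deriveN//; apply: derive_le => [|t t0].
  exact: derivableN.
rewrite -opprD mulrN lerN2 q// ler_pdivlMr ?exprn_even_gt0//.
by case/andP: (hab t).
Qed.

Lemma deriveD_dir h x u v : differentiable h x ->
  'D_(u + v) h x = 'D_u h x + 'D_v h x.
Proof. by move=> dh; rewrite !deriveE// linearD. Qed.

Lemma derive_scale h z (t : R) d : differentiable h z ->
  'D_(t *: d) h z = t * 'D_d h z.
Proof. by move=> dh; rewrite !deriveE // linearZ. Qed.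

Lemma derive_shiftr h a z d : 'D_d (fun x => h (x + a)) z = 'D_d h (z + a).
Proof.
rewrite /derive.
have -> // : (fun t : R =>
    t^-1 *: (((fun x => h (x + a)) \o shift z) (t *: d) - h (z + a))) =
  fun t => t^-1 *: ((h \o shift (z + a)) (t *: d) - h (z + a)).
by apply/funext => t; rewrite /= addrA.
Qed.

Lemma differentiable_shiftr h a z : differentiable h (z + a) ->
  differentiable (fun x => h (x + a)) z.
Proof.
move=> dh; apply: (@differentiable_comp _ _ _ _ (fun x => x + a) h) => //.
Qed.

(** The second derivative is only known to exist at [z], not to be continuous. So the mean value
    theorem is applied once, along [u], and the resulting first derivatives are expanded to first
    order at [z]. *)
Lemma second_difference_near h z u v (e : R) : (forall x, differentiable h x) ->
  differentiable (fun x => 'D_u h x) z -> 0 < e ->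
  \forall t \near (0 : R),
    `|h (z + t *: u + t *: v) - h (z + t *: u) - h (z + t *: v) + h z
      - t ^+ 2 * 'D_v (fun x => 'D_u h x) z| <= e * t ^+ 2.
Proof.
move=> dh dD e0; set D := fun x => 'D_u h x.
(* The two displacements [x1] and [x2] below have total length at most [m] times [|t|]; the summand
   1 keeps [m] positive. *)
pose m := 2 * (`|u| + `|v|) + 1.
have m0 : 0 < m by rewrite /m; have := normr_ge0 u; have := normr_ge0 v; lra.
have em0 : 0 < e / m by rewrite divr_gt0.
have [r r0 Hr] : exists2 r : R, 0 < r & forall x, `|x| < r ->
    `|D (z + x) - D z - 'd D z x| <= e / m * `|x|.
  have := diff_locally dD; set k := 'o _ => Dk.
  have /(littleoP [littleo of k]) /nbhs_ballP[i i0 Hi] := em0.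
  exists i => // x xi.
  have -> : D (z + x) = (D \o shift z) x by rewrite /= addrC.
  rewrite Dk /= -addrA -opprD [X in X - _]addrC addrK.
  by apply: Hi; rewrite -ball_normE /= add0r normrN.
apply/nbhs_ballP; exists (r / m) => [|t]; first by rewrite /= divr_gt0.
rewrite -ball_normE /= add0r normrN => tr.
pose G x := h (x + (z + t *: v)) - h (x + z).
have dG x : differentiable G x.
  by apply: differentiableB; exact: differentiable_shiftr.
have DG x d : 'D_d G x = 'D_d h (x + (z + t *: v)) - 'D_d h (x + z).
  rewrite deriveB ?derive_shiftr//; apply: diff_derivable; exact: differentiable_shiftr.
have [c /andP[c0 c1]] := line_MVT 0 (t *: u) dG.
rewrite DG !derive_scale// !add0r -mulrBr => E.
have -> : h (z + t *: u + t *: v) - h (z + t *: u) - h (z + t *: v) + h z =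
   G (t *: u) - G 0.
  rewrite /G !add0r [t *: u + z]addrC [t *: u + (z + _)]addrCA addrA; ring.
rewrite {}E.
set x1 := c *: (t *: u) + t *: v; set x2 := c *: (t *: u).
have -> : c *: (t *: u) + (z + t *: v) = z + x1 by rewrite addrCA.
rewrite [_ + z]addrC -/x2 -![derive _ _ _]/(D _).
have nx2 : `|x2| <= `|t| * `|u|.
  by rewrite !normrZ (ger0_norm c0) ler_piMl// mulr_ge0.
have nx1 : `|x1| <= `|t| * (`|u| + `|v|).
  by rewrite (le_trans (ler_normD _ _))// mulrDr lerD// normrZ.
have nv := normr_ge0 v; have nu := normr_ge0 u; have nt := normr_ge0 t.
have tm : `|t| * m < r by rewrite -ltr_pdivlMr.
have x1r : `|x1| < r.
  by apply: le_lt_trans nx1 _; apply: le_lt_trans tm; rewrite ler_wpM2l// /m; lra.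
have x2r : `|x2| < r.
  by apply: le_lt_trans nx2 _; apply: le_lt_trans tm; rewrite ler_wpM2l// /m; lra.
have H1 := Hr _ x1r; have H2 := Hr _ x2r.
(* Since [x1 - x2 = t *: v], the unknown intermediate point [c] cancels from the linear parts; only
   the two remainders survive. *)
have dx : 'd D z x1 - 'd D z x2 = t * 'D_v D z.
  by rewrite -linearB /x1 -/x2 addrC addKr linearZ /= deriveE.
have -> : t * (D (z + x1) - D (z + x2)) - t ^+ 2 * 'D_v D z =
   t * ((D (z + x1) - D z - 'd D z x1) - (D (z + x2) - D z - 'd D z x2)).
  have -> : t ^+ 2 * 'D_v D z = t * ('d D z x1 - 'd D z x2) by rewrite dx; ring.
  ring.
rewrite normrM -(ger0_norm (sqr_ge0 t)) normrX expr2 mulrCA.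
rewrite ler_wpM2l// (le_trans (ler_normB _ _))//.
apply: le_trans (lerD H1 H2) _.
rewrite -mulrDr mulrAC ler_pdivrMr// -mulrA ler_wpM2l ?(ltW e0)//.
by rewrite /m; nra.
Qed.

(** The second difference is symmetric in [u] and [v], so at one small nonzero [t] both mixed
    derivatives are within [e / 2] of the same quotient. *)
Lemma second_derive_sym h z u v : (forall x, differentiable h x) ->
  differentiable (fun x => 'D_u h x) z -> differentiable (fun x => 'D_v h x) z ->
  'D_v (fun x => 'D_u h x) z = 'D_u (fun x => 'D_v h x) z.
Proof.
move=> dh du dv; apply/eqP; rewrite -subr_eq0 -normr_le0; apply/ler_addgt0Pl => e e0.
rewrite addr0.
have e2 : 0 < e / 2 by lra.
have H1 := second_difference_near v dh du e2.
have H2 := second_difference_near u dh dv e2.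
have K3 : (\forall t \near 0^', t != 0 :> R)%classic by exact: nbhs_dnbhs_neq.
have {}H1 := nbhs_dnbhs H1; have {}H2 := nbhs_dnbhs H2.
have FF : ProperFilter (dnbhs (0 : R)) by exact: Proper_dnbhs_numFieldType.
have [t [[t0 K1] K2]] := filter_ex (filterI (filterI K3 H1) H2).
have t2 : 0 < t ^+ 2 by rewrite exprn_even_gt0.
move: K1 K2 => /=; rewrite [z + t *: v + _]addrAC.
move: ('D_v _ z) ('D_u _ z) (h (z + t *: u + _)) (h (z + t *: u)) (h (z + t *: v))
  (h z) (t ^+ 2) t2 => D1 D2 a b c d s s0 K1 K2.
rewrite -(ler_pM2r s0) -{1}(ger0_norm (ltW s0)) -normrM.
move: K1 K2; rewrite !ler_norml => /andP[K1 K1'] /andP[K2 K2'].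
by apply/andP; split; lra.
Qed.

End Calculus.

(** * Euclidean inner product, gradients, strong convexity *)

Section Dot.
Variables (R : realType) (n : nat).
Implicit Types (u v w : 'rV[R]_n) (g : 'rV[R]_n -> R).

Lemma dotvC u v : dotv u v = dotv v u.
Proof. by apply: eq_bigr => i _; rewrite mulrC. Qed.

Lemma dotvDl u v w : dotv (u + v) w = dotv u w + dotv v w.
Proof. by rewrite /dotv -big_split; apply: eq_bigr => i _; rewrite !mxE mulrDl. Qed.

Lemma dotvZl (a : R) u v : dotv (a *: u) v = a * dotv u v.
Proof. by rewrite /dotv big_distrr; apply: eq_bigr => i _; rewrite !mxE -mulrA. Qed.

Lemma dotvNl u v : dotv (- u) v = - dotv u v.
Proof. by rewrite -scaleN1r dotvZl mulN1r. Qed.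

Lemma dotvBl u v w : dotv (u - v) w = dotv u w - dotv v w.
Proof. by rewrite dotvDl dotvNl. Qed.

Lemma dotvZr (a : R) u v : dotv u (a *: v) = a * dotv u v.
Proof. by rewrite dotvC dotvZl dotvC. Qed.

Lemma dotvNr u v : dotv u (- v) = - dotv u v.
Proof. by rewrite dotvC dotvNl dotvC. Qed.

Lemma dotvBr u v w : dotv u (v - w) = dotv u v - dotv u w.
Proof. by rewrite dotvC dotvBl ![dotv u _]dotvC. Qed.

Lemma dotv_parallelogram u v :
  dotv (u + v) (u + v) + dotv (u - v) (u - v) = 2 * (dotv u u + dotv v v).
Proof.
rewrite dotvDl dotvBl (dotvC u (u + v)) (dotvC v (u + v)) (dotvC u (u - v)).
by rewrite (dotvC v (u - v)) !dotvDl !dotvNl; lra.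
Qed.

Lemma dotv_ge0 u : 0 <= dotv u u.
Proof. by apply: sumr_ge0 => i _; rewrite -expr2 sqr_ge0. Qed.

Lemma dotv_eq0 u : dotv u u = 0 -> u = 0.
Proof.
move=> /eqP; rewrite psumr_eq0 => [/allP h|i _]; last by rewrite -expr2 sqr_ge0.
apply/rowP => i; rewrite mxE; have := h i (mem_index_enum _).
by rewrite mulf_eq0 orbb => /eqP.
Qed.

Lemma sqr_enorm u : enorm u ^+ 2 = dotv u u.
Proof. by rewrite sqr_sqrtr// dotv_ge0. Qed.

Lemma enorm_ge0 u : 0 <= enorm u.
Proof. exact: sqrtr_ge0. Qed.

Lemma enormZ (a : R) u : enorm (a *: u) = `|a| * enorm u.
Proof. by rewrite /enorm dotvZl dotvZr mulrA -expr2 sqrtrM ?sqr_ge0// sqrtr_sqr. Qed.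

Lemma dotv_cauchy u v : `|dotv u v| <= enorm u * enorm v.
Proof.
rewrite -(ler_pXn2r (n := 2)) ?nnegrE ?mulr_ge0 ?enorm_ge0//.
rewrite exprMn !sqr_enorm real_normK ?num_real//.
have [v0|v0] := eqVneq (dotv v v) 0.
  have -> : dotv u v = 0 by rewrite (dotv_eq0 v0) -(subrr u) dotvBr subrr.
  by rewrite expr0n v0 mulr0.
have vp : 0 < dotv v v by rewrite lt_neqAle eq_sym v0 dotv_ge0.
(* This vector is |v|^2 times the component of [u] orthogonal to [v]. *)
have := dotv_ge0 (dotv v v *: u - dotv u v *: v).
rewrite dotvBl !dotvBr !dotvZl !dotvZr (dotvC v u).
move: (dotv u v) (dotv u u) (dotv v v) vp => a b c c0 h.
rewrite -(ler_pM2l c0); nra.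
Qed.

Lemma derive_grad g u v : differentiable g u -> 'D_v g u = dotv (grad g u) v.
Proof.
move=> dg; rewrite deriveE // [in LHS](row_sum_delta v) linear_sum.
by apply: eq_bigr => i _; rewrite mxE linearZ /= deriveE // mulrC.
Qed.

Lemma gradN g u : differentiable g u -> grad (fun x => - g x) u = - grad g u.
Proof.
move=> dg; apply/rowP => i; rewrite !mxE -deriveN//; exact: diff_derivable.
Qed.

(** Sum of the convexity inequalities at ([u], [v]) and ([v], [u]). *)
Lemma strongly_convex_monotone (mu : R) g : strongly_convex mu g ->
  forall u v, mu * dotv (v - u) (v - u) <= dotv (grad g v - grad g u) (v - u).
Proof.
move=> sc u v; have := sc u v; have := sc v u.
rewrite !sqr_enorm -(opprB v u) !dotvNr !dotvNl (dotvBl (grad g v)); lra.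
Qed.

(* At a minimizer [u], compare [g u] with [g] at the short gradient step
   [u - t *: grad g u]: convexity makes the value there strictly smaller. *)
Lemma grad_minimizer (mu L : R) g u : 0 < mu -> 0 < L -> strongly_convex mu g ->
  (forall v w, enorm (grad g w - grad g v) <= L * enorm (w - v)) ->
  (forall v, g u <= g v) -> grad g u = 0.
Proof.
move=> mu0 L0 sc lip mn; set p := grad g u; apply: dotv_eq0.
(* With [t * L] equal to 1/2 the gradient at [v] differs from [p] by at most half the length of [p],
   so its inner product with [p] is still at least |p|^2 / 2. *)
pose t := (2 * L)^-1; have t0 : 0 < t by rewrite invr_gt0; lra.
have tL : t * L = 2^-1 by rewrite /t; field; rewrite gt_eqF.
pose v := u - t *: p.
have vu : v - u = - t *: p by rewrite /v addrC addKr scaleNr.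
have := sc v u; rewrite -(opprB v u) vu sqr_enorm scaleNr opprK dotvZl !dotvZr.
have := mn v; have := lip u v.
rewrite vu enormZ normrN gtr0_norm// -/p => lv mv h.
have cs := dotv_cauchy (grad g v - p) p.
have cs' : `|dotv (grad g v - p) p| <= 2^-1 * dotv p p.
  apply: le_trans cs _; rewrite -sqr_enorm -tL.
  have := ler_wpM2r (enorm_ge0 p) lv; lra.
rewrite dotvBl ler_norml in cs'; case/andP: cs' => c1 c2.
have pp := dotv_ge0 p; apply/eqP; rewrite eq_le pp andbT.
have tp : 0 <= mu / 2 * (t * (t * dotv p p)).
  by rewrite !mulr_ge0// ?(ltW t0)//; lra.
have : t * dotv (grad g v) p <= 0 by lra.
rewrite pmulr_rle0//; lra.
Qed.

End Dot.

(** * Bilinear forms with a saddle block structure, in the weighted norm *)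

Section Forms.
Variables (R : realType).

Lemma polarization (V : zmodType) (A : V -> V -> R) (d w : V) :
  (forall u v, A u v = A v u) -> (forall u v x, A (u + v) x = A u x + A v x) ->
  A (d + w) (d + w) - A (d - w) (d - w) = 4 * A d w.
Proof.
move=> AC AD.
have AN u v : A (- u) v = - A u v.
  have A0 : A 0 v = 0 by have := AD 0 0 v; rewrite addr0; lra.
  by have := AD u (- u) v; rewrite subrr A0; lra.
rewrite !AD AN ![A _ (d + w)]AC ![A _ (d - w)]AC !AD !AN (AC w d); lra.
Qed.

Variables (m n : nat) (alpha beta eta kappa k rho mux muy Lx Ly Lxy : R).
Hypotheses (al0 : 0 < alpha) (be0 : 0 < beta) (Lxy0 : 0 <= Lxy) (ek0 : 0 <= eta * k).
Hypotheses (amu : alpha * mux = eta) (bmu : beta * muy = eta).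
Hypotheses (aL : alpha * Lx <= eta * kappa) (bL : beta * Ly <= eta * kappa).
Hypothesis abL : alpha * beta * Lxy ^+ 2 <= (eta * k) ^+ 2.
(** The eigenvalue bound for the two-by-two matrix, stated as a quadratic inequality so that no
    eigenvalue has to be computed. *)
Hypothesis rate : forall P Q : R, 0 <= P -> 0 <= Q ->
  (1 - eta) * P ^+ 2 - (1 - eta * kappa) * Q ^+ 2 + 2 * (eta * k) * (P * Q)
    <= rho * (P ^+ 2 + Q ^+ 2).

Definition wnorm2 (x : 'rV[R]_m) (y : 'rV[R]_n) := dotv x x / alpha + dotv y y / beta.

Lemma wnorm2_ge0 x y : 0 <= wnorm2 x y.
Proof. by rewrite addr_ge0// divr_ge0 ?dotv_ge0// ltW. Qed.

(** Cauchy-Schwarz for the weighted norm; after squaring, the gap is the square of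
    [beta * a * c - alpha * b * d] up to a nonnegative factor. *)
Lemma cross_bound (a b c d : R) : 0 <= a -> 0 <= b -> 0 <= c -> 0 <= d ->
  Lxy * (a * d + b * c) <= eta * k * (Num.sqrt (a ^+ 2 / alpha + b ^+ 2 / beta) *
    Num.sqrt (c ^+ 2 / alpha + d ^+ 2 / beta)).
Proof.
move=> a0 b0 c0 d0.
have s0 x y : 0 <= x ^+ 2 / alpha + y ^+ 2 / beta.
  by rewrite addr_ge0// divr_ge0 ?sqr_ge0// ltW.
rewrite -(ler_pXn2r (n := 2)) ?nnegrE//; last 2 first.
- by apply: mulr_ge0 => //; apply: addr_ge0; exact: mulr_ge0.
- by apply: mulr_ge0 => //; apply: mulr_ge0; exact: sqrtr_ge0.
rewrite [(_ * (_ + _)) ^+ 2]exprMn [(eta * k * _) ^+ 2]exprMn [X in _ <= _ * X]exprMn.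
rewrite !sqr_sqrtr//.
apply: (@le_trans _ _ (alpha * beta * Lxy ^+ 2 *
   ((a ^+ 2 / alpha + b ^+ 2 / beta) * (c ^+ 2 / alpha + d ^+ 2 / beta)))); last first.
  by rewrite ler_wpM2r// mulr_ge0.
rewrite -subr_ge0.
have -> : alpha * beta * Lxy ^+ 2 *
   ((a ^+ 2 / alpha + b ^+ 2 / beta) * (c ^+ 2 / alpha + d ^+ 2 / beta)) -
   Lxy ^+ 2 * (a * d + b * c) ^+ 2 =
   (Lxy * (beta * a * c - alpha * b * d)) ^+ 2 / (alpha * beta).
  by field; rewrite !gt_eqF.
by rewrite divr_ge0 ?sqr_ge0// mulr_ge0 ?(ltW al0) ?(ltW be0).
Qed.

(** The right side averages two squared norms instead of multiplying two norms. This is what the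
    parallelogram law yields, and rescaling the second vector recovers the product form later. *)
Lemma saddle_form_bound (A : 'rV[R]_m -> 'rV[R]_m -> R)
  (B : 'rV[R]_m -> 'rV[R]_n -> R) (C : 'rV[R]_n -> 'rV[R]_n -> R) :
  (forall u v, A u v = A v u) -> (forall u v x, A (u + v) x = A u x + A v x) ->
  (forall u v, C u v = C v u) -> (forall u v x, C (u + v) x = C u x + C v x) ->
  (forall u v x, B (u + v) x = B u x + B v x) ->
  (forall x u v, B x (u + v) = B x u + B x v) ->
  (forall u, mux * dotv u u <= A u u <= Lx * dotv u u) ->
  (forall u, muy * dotv u u <= C u u <= Ly * dotv u u) ->
  (forall u v, `|B u v| <= Lxy * (enorm u * enorm v)) ->
  forall d1 w1 d2 w2,
  dotv d1 w1 / alpha + dotv d2 w2 / beta - A d1 w1 - C d2 w2 + B d1 w2 - B w1 d2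
    <= rho / 2 * (wnorm2 d1 d2 + wnorm2 w1 w2).
Proof.
move=> AC AD CC CD BDl BDr Ab Cb Bb d1 w1 d2 w2.
have BNl u v : B (- u) v = - B u v.
  have B0 : B 0 v = 0 by have := BDl 0 0 v; rewrite addr0; lra.
  by have := BDl u (- u) v; rewrite subrr B0; lra.
have BNr u v : B u (- v) = - B u v.
  have B0 : B u 0 = 0 by have := BDr u 0 0; rewrite addr0; lra.
  by have := BDr u v (- v); rewrite subrr B0; lra.
have pA := polarization d1 w1 AC AD.
have pC := polarization d2 w2 CC CD.
have pX := polarization d1 w1 (@dotvC R m) (@dotvDl R m).
have pY := polarization d2 w2 (@dotvC R n) (@dotvDl R n).
(* The coupling is skew, so it pairs a component of the sum with a component of the difference; this
   produces the product [P * Q]. *)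
have pB : B (d1 + w1) (d2 - w2) - B (d1 - w1) (d2 + w2) = 2 * (B w1 d2 - B d1 w2).
  by rewrite !BDl !BDr !BNl !BNr; lra.
have sX := dotv_parallelogram d1 w1.
have sY := dotv_parallelogram d2 w2.
move: (d1 + w1) (d1 - w1) (d2 + w2) (d2 - w2) pA pC pX pY pB sX sY
  => p1 q1 p2 q2 pA pC pX pY pB sX sY.
have N0 := wnorm2_ge0.
have := rate (sqrtr_ge0 (wnorm2 p1 p2)) (sqrtr_ge0 (wnorm2 q1 q2)).
have := cross_bound (enorm_ge0 p1) (enorm_ge0 p2) (enorm_ge0 q1) (enorm_ge0 q2).
rewrite !sqr_enorm -!/(wnorm2 _ _) !sqr_sqrtr//.
move: (_ * Num.sqrt _) => S cr rt.
have := Bb p1 q2; have := Bb q1 p2; rewrite !ler_norml => /andP[_ b1] /andP[b2 _].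
(* After polarization the diagonal blocks enter negatively on the sums [p1], [p2] and positively on
   the differences [q1], [q2], hence lower bounds for the former and upper bounds for the latter. *)
have /andP[a1 _] := Ab p1; have /andP[_ a2] := Ab q1.
have /andP[c1 _] := Cb p2; have /andP[_ c2] := Cb q2.
have m1 (x : 'rV[R]_m) : mux * dotv x x = eta * (dotv x x / alpha).
  by rewrite -amu; field; rewrite gt_eqF.
have m2 (x : 'rV[R]_n) : muy * dotv x x = eta * (dotv x x / beta).
  by rewrite -bmu; field; rewrite gt_eqF.
have l1 : Lx * dotv q1 q1 <= eta * kappa * (dotv q1 q1 / alpha).
  rewrite mulrA ler_pdivlMr// mulrAC (mulrC Lx) ler_wpM2r// dotv_ge0//.
have l2 : Ly * dotv q2 q2 <= eta * kappa * (dotv q2 q2 / beta).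
  rewrite mulrA ler_pdivlMr// mulrAC (mulrC Ly) ler_wpM2r// dotv_ge0//.
rewrite m1 in a1; rewrite m2 in c1.
have E : wnorm2 p1 p2 + wnorm2 q1 q2 = 2 * (wnorm2 d1 d2 + wnorm2 w1 w2).
  rewrite /wnorm2 addrACA -!mulrDl sX sY; lra.
have F : wnorm2 p1 p2 - wnorm2 q1 q2 = 4 * (dotv d1 w1 / alpha + dotv d2 w2 / beta).
  rewrite /wnorm2 opprD addrACA -!mulrBl pX pY; lra.
rewrite E in rt.
rewrite /wnorm2 in rt F *; lra.
Qed.

End Forms.

(** The variable [x] stands for [kx + ky + kxy ^+ 2], which lies between [kappa + k ^+ 2] and twice
    that value when [kappa] is the maximum of [kx] and [ky]. *)
Lemma step_size_exists (R : realType) (kappa k : R) : 1 <= kappa -> 0 <= k ->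
  let s := (k + Num.sqrt (kappa + k ^+ 2)) ^+ 2 in
  let rho := (s - 1) / (s + 1) in
  exists eta : R, [/\ 0 < eta,
    forall x, kappa + k ^+ 2 <= x -> 2 / 5 / x <= eta,
    forall x, 0 < x -> x <= 2 * (kappa + k ^+ 2) -> eta <= 8 / x,
    0 <= rho &
    forall P Q, (1 - eta) * P ^+ 2 - (1 - eta * kappa) * Q ^+ 2
      + 2 * (eta * k) * (P * Q) <= rho * (P ^+ 2 + Q ^+ 2)].
Proof.
move=> K1 k0; have k2 := sqr_ge0 k.
have := sqrtr_ge0 (kappa + k ^+ 2).
have := @sqr_sqrtr _ (kappa + k ^+ 2) (ltac:(lra)).
move: (Num.sqrt _) => q qE q0; have [p pE] : exists p, p = k + q by exists (k + q).
rewrite -pE /=.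
have q1 : 1 <= q by rewrite -(ler_pXn2r (n := 2)) ?nnegrE// qE expr1n; lra.
have kq : k <= q by rewrite -(ler_pXn2r (n := 2)) ?nnegrE// qE; lra.
have [qp p2q pp] : [/\ q <= p, p <= 2 * q & 0 < p ^+ 2 + 1].
  by have := sqr_ge0 p; split; lra.
have qpp : 0 < q * (p ^+ 2 + 1) by rewrite mulr_gt0//; lra.
exists (2 * p / (q * (p ^+ 2 + 1))); split.
- by rewrite divr_gt0//; lra.
(* From [q <= p] the step is at least 2 / (p^2 + 1), and [p <= 2 * q] with [1 <= x] gives p^2 + 1 <=
   5 x: this is the constant 2/5. *)
- move=> x xk; rewrite ler_pdivrMr; last by lra.
  rewrite mulrAC ler_pdivlMr//.
  have p2 : p ^+ 2 <= 4 * x.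
    apply: (@le_trans _ _ ((2 * q) ^+ 2)); last by rewrite exprMn qE; lra.
    by rewrite ler_pXn2r ?nnegrE//; lra.
  apply: (@le_trans _ _ (2 / 5 * (p * (p ^+ 2 + 1)))).
    by rewrite ler_wpM2l ?ler_wpM2r ?(ltW pp)//; lra.
  have -> : 2 / 5 * (p * (p ^+ 2 + 1)) = p * (2 / 5 * (p ^+ 2 + 1)) by ring.
  have -> : 2 * p * x = p * (2 * x) by ring.
  by rewrite ler_wpM2l; lra.
(* From [p <= 2 * q] the step is at most 4 / (p^2 + 1), and p^2 >= q^2 >= x / 2: this is the
   constant 8. *)
- move=> x x0 xk; rewrite ler_pdivlMr// mulrAC ler_pdivrMr//.
  have p2 : kappa + k ^+ 2 <= p ^+ 2 by rewrite -qE ler_pXn2r ?nnegrE//; lra.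
  apply: (@le_trans _ _ (4 * q * x)); first by rewrite ler_wpM2r; lra.
  have -> : 8 * (q * (p ^+ 2 + 1)) = 4 * q * (2 * (p ^+ 2 + 1)) by ring.
  by rewrite ler_wpM2l; lra.
- by rewrite divr_ge0 ?(ltW pp)// subr_ge0 exprn_ege1//; lra.
move=> P Q; rewrite -subr_ge0.
(* for this step size the defect is a rank-one square *)
rewrite [X in 0 <= X](_ : _ = 2 * k / (q * (p ^+ 2 + 1)) * (P - p * Q) ^+ 2);
  last first.
  have -> : kappa = q ^+ 2 - k ^+ 2 by rewrite qE addrK.
  have -> : k = p - q by rewrite pE addrK.
  by field; rewrite !gt_eqF//; lra.
by rewrite mulr_ge0 ?sqr_ge0// divr_ge0 ?mulr_ge0 ?(ltW pp)//; lra.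
Qed.

(** * The Hessian of the saddle function, its block bounds, and the contraction of one step *)

Section SaddleFunction.
Variables (R : realType) (dx dy : nat) (f : 'rV[R]_dx * 'rV[R]_dy -> R).
Implicit Types (z d w : 'rV[R]_dx * 'rV[R]_dy).

Lemma differentiable_partial1 z : differentiable f z ->
  differentiable (fun x => f (x, z.2)) z.1.
Proof.
case: z => x y df; apply: (@differentiable_comp _ _ _ _ (fun x => (x, y)) f) => //.
Qed.

Lemma differentiable_partial2 z : differentiable f z ->
  differentiable (fun y => f (z.1, y)) z.2.
Proof.
case: z => x y df; apply: (@differentiable_comp _ _ _ _ (fun y => (x, y)) f) => //.
Qed.

Lemma derive_gradx z u : differentiable f z -> 'D_(u, 0) f z = dotv (gradx f z) u.
Proof.
move=> df; rewrite -derive_grad; last exact: differentiable_partial1.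
rewrite /derive.
have -> // : (fun t : R => t^-1 *: ((f \o shift z) (t *: (u, 0)) - f z)) =
  fun t => t^-1 *: (((fun x => f (x, z.2)) \o shift z.1) (t *: u) - f (z.1, z.2)).
apply/funext => t /=; case: z df => x y df /=.
by congr (_ *: (f (_, _) - _)); rewrite /= scaler0 add0r.
Qed.

Lemma derive_grady z v : differentiable f z -> 'D_(0, v) f z = dotv (grady f z) v.
Proof.
move=> df; rewrite -derive_grad; last exact: differentiable_partial2.
rewrite /derive.
have -> // : (fun t : R => t^-1 *: ((f \o shift z) (t *: (0, v)) - f z)) =
  fun t => t^-1 *: (((fun y => f (z.1, y)) \o shift z.2) (t *: v) - f (z.1, z.2)).
apply/funext => t /=; case: z df => x y df /=.
by congr (_ *: (f (_, _) - _)); rewrite /= scaler0 add0r.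
Qed.

Lemma differentiable_dotv (V : normedModType R) n (g : V -> 'rV[R]_n) u (z : V) :
  differentiable g z -> differentiable (fun x => dotv (g x) u) z.
Proof.
move=> dg.
have -> : (fun x => dotv (g x) u) = \sum_(i < n) (fun x => g x 0 i * u 0 i).
  by apply/funext => x; rewrite fct_sumE.
apply: differentiable_sum => i; apply: differentiableM; last exact: differentiable_cst.
apply: (@differentiable_comp _ _ _ _ g (fun M : 'rV[R]_n => M 0 i)) => //.
exact: differentiable_coord.
Qed.

Hypothesis f2 : twice_differentiable f.

Let df z : differentiable f z. Proof. exact: f2.1. Qed.

Lemma derive_split d z : 'D_d f z = dotv (gradx f z) d.1 + dotv (grady f z) d.2.
Proof.
rewrite -(derive_gradx d.1 (df z)) -(derive_grady d.2 (df z)).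
rewrite -(deriveD_dir (d.1, 0) (0, d.2) (df z)).
case: d => a b; rewrite -[X in 'D_X f z = _]/(a, b).
by rewrite -[X in _ = 'D_X f z]/(a + 0, 0 + b) addr0 add0r.
Qed.

(** Twice differentiability is given through the two partial gradients; splitting the direction [d]
    transfers it to every directional derivative. *)
Lemma differentiable_derive d z : differentiable (fun x => 'D_d f x) z.
Proof.
have -> : (fun x => 'D_d f x) =
    (fun x => dotv (gradx f x) d.1) + (fun x => dotv (grady f x) d.2).
  by apply/funext => x; rewrite derive_split.
have [dgx dgy] := f2.2 z.
by apply: differentiableD; exact: differentiable_dotv.
Qed.

(** The Hessian as a bilinear form of directions: additivity in the outer direction [d] comes from
    differentiability, and in [w] from symmetry. *)
Definition hess z d w : R := 'D_d (fun x => 'D_w f x) z.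

Lemma hessC z d w : hess z d w = hess z w d.
Proof. by apply: second_derive_sym => //; exact: differentiable_derive. Qed.

Lemma hessDl z d d' w : hess z (d + d') w = hess z d w + hess z d' w.
Proof. by rewrite /hess deriveD_dir//; exact: differentiable_derive. Qed.

Variables (mux muy Lx Ly Lxy : R).
Hypotheses (mux0 : 0 < mux) (muxL : mux <= Lx) (muy0 : 0 < muy) (muyL : muy <= Ly).
Hypotheses (Lxy0 : 0 <= Lxy) (fc : in_class mux muy Lx Ly Lxy f).

(** Difference quotients of [gradx]: strong monotonicity gives the lower bound, Cauchy-Schwarz with
    the Lipschitz constant the upper one. *)
Lemma hess_xx_bounds z u :
  mux * dotv u u <= hess z (u, 0) (u, 0) <= Lx * dotv u u.
Proof.
apply: derive_bounds => [|t]; first exact/diff_derivable/differentiable_derive.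
rewrite !derive_gradx//; case: z => x y.
have -> : t *: (u, 0) + (x, y) = (t *: u + x, y).
  by congr pair; rewrite /= scaler0 add0r.
have E : t *: u + x - x = t *: u by rewrite addrK.
have M := strongly_convex_monotone (class_convex fc y) x (t *: u + x).
have L := le_trans (ler_norm _) (dotv_cauchy
  (gradx f (t *: u + x, y) - gradx f (x, y)) (t *: u)).
have := class_lip_xx fc x (t *: u + x) y.
rewrite E in M *; move=> /(ler_wpM2r (enorm_ge0 (t *: u))) /(le_trans L).
rewrite -(mulrA Lx (enorm _)) -(expr2 (enorm (t *: u))) sqr_enorm -dotvBl => L'.
have sE (c : R) : c * dotv u u * t ^+ 2 = c * dotv (t *: u) (t *: u).
  by rewrite dotvZl dotvZr; ring.
by rewrite !sE -(dotvZr t _ u); apply/andP; split.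
Qed.

Lemma hess_yy_bounds z v :
  muy * dotv v v <= - hess z (0, v) (0, v) <= Ly * dotv v v.
Proof.
suff /andP[h1 h2] : - (Ly * dotv v v) <= hess z (0, v) (0, v) <= - (muy * dotv v v).
  by apply/andP; split; lra.
apply: derive_bounds => [|t]; first exact/diff_derivable/differentiable_derive.
rewrite !derive_grady//; case: z => x y.
have -> : t *: (0, v) + (x, y) = (x, t *: v + y).
  by congr pair; rewrite /= scaler0 add0r.
have E : t *: v + y - y = t *: v by rewrite addrK.
have M := strongly_convex_monotone (class_concave fc x) y (t *: v + y).
have L := dotv_cauchy (grady f (x, t *: v + y) - grady f (x, y)) (t *: v).
have := class_lip_yy fc x y (t *: v + y).
have gN y' : grad (fun y => - f (x, y)) y' = - grady f (x, y').
  by rewrite gradN//; exact: (differentiable_partial2 (z := (x, y'))).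
rewrite E !gN -opprD dotvNl in M *.
move=> /(ler_wpM2r (enorm_ge0 (t *: v))) /(le_trans L).
rewrite -(mulrA Ly (enorm _)) -(expr2 (enorm (t *: v))) sqr_enorm ler_norml.
have sE (c : R) : - (c * dotv v v) * t ^+ 2 = - (c * dotv (t *: v) (t *: v)).
  by rewrite dotvZl dotvZr; ring.
rewrite !sE -dotvBl -(dotvZr t _ v) => /andP[h1 _]; apply/andP; split => //.
by rewrite lerNr.
Qed.

Lemma hess_xy_bound z u v : `|hess z (u, 0) (0, v)| <= Lxy * (enorm u * enorm v).
Proof.
(* Symmetry puts the y-direction outside, so the quotient is one of [gradx] with [y] moving, which
   [Lxy] controls. *)
rewrite ler_norml hessC.
apply: derive_bounds => [|t]; first exact/diff_derivable/differentiable_derive.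
rewrite !derive_gradx//; case: z => x y.
have -> : t *: (0, v) + (x, y) = (x, t *: v + y).
  by congr pair; rewrite /= scaler0 add0r.
have E : t *: v + y - y = t *: v by rewrite addrK.
have L := dotv_cauchy (gradx f (x, t *: v + y) - gradx f (x, y)) u.
have := class_lip_xy fc x y (t *: v + y).
rewrite E enormZ -dotvBl => /(ler_wpM2r (enorm_ge0 u)) /(le_trans L) {}L.
have := ler_wpM2l (normr_ge0 t) L.
rewrite -normrM => {}L; rewrite mulNr -ler_norml; apply: le_trans L _.
rewrite -(real_normK (num_real t)) expr2.
by rewrite le_eqVlt; apply/orP; left; apply/eqP; ring.
Qed.

Variable zs : 'rV[R]_dx * 'rV[R]_dy.
Hypothesis nash : nash_equilibrium f zs.

Lemma nash_grad0 : gradx f zs = 0 /\ grady f zs = 0.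
Proof.
case: zs nash => xs ys /= n; split.
  apply: (grad_minimizer mux0 (lt_le_trans mux0 muxL) (class_convex fc ys)).
    by move=> v w; exact: (class_lip_xx fc).
  by move=> v; have [] := n v ys.
have gN y : grad (fun y => - f (xs, y)) y = - grady f (xs, y).
  by rewrite gradN//; exact: (differentiable_partial2 (z := (xs, y))).
apply/eqP; rewrite -oppr_eq0 -gN; apply/eqP.
apply: (grad_minimizer muy0 (lt_le_trans muy0 muyL) (class_concave fc xs)).
  move=> v w; rewrite !gN -opprD -scaleN1r enormZ normrN1 mul1r.
  exact: (class_lip_yy fc).
by move=> v; rewrite lerN2; have [] := n xs v.
Qed.

Variables (alpha beta eta kappa k rho : R).
Hypotheses (al0 : 0 < alpha) (be0 : 0 < beta) (ek0 : 0 <= eta * k) (rho0 : 0 <= rho).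
Hypotheses (amu : alpha * mux = eta) (bmu : beta * muy = eta).
Hypotheses (aL : alpha * Lx <= eta * kappa) (bL : beta * Ly <= eta * kappa).
Hypothesis abL : alpha * beta * Lxy ^+ 2 <= (eta * k) ^+ 2.
Hypothesis rate : forall P Q : R, 0 <= P -> 0 <= Q ->
  (1 - eta) * P ^+ 2 - (1 - eta * kappa) * Q ^+ 2 + 2 * (eta * k) * (P * Q)
    <= rho * (P ^+ 2 + Q ^+ 2).

(** The test vector [v] is left arbitrary, so that it can later be a multiple of the new
    displacement. The weights of the norm cancel the step sizes in front of the gradients. *)
Lemma sim_gda_step_form z v :
  let w := sim_gda_step alpha beta f z - zs in let d := z - zs in
  dotv w.1 v.1 / alpha + dotv w.2 v.2 / beta
    <= rho / 2 * (wnorm2 alpha beta d.1 d.2 + wnorm2 alpha beta v.1 v.2).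
Proof.
cbv zeta; set w := _ - zs; set d := z - zs; have [gx0 gy0] := nash_grad0.
(* This is the ascent-descent field tested against [v]. It vanishes at [zs], and being scalar it
   satisfies the mean value theorem with a single point [x]. *)
pose h x := 'D_(0, v.2) f x - 'D_(v.1, 0) f x.
have dD e x := differentiable_derive e x.
have dh x : differentiable h x by exact: differentiableB.
have [c _] := line_MVT zs d dh.
have -> : zs + d = z by rewrite addrC subrK.
set x := zs + c *: d.
have -> : 'D_d h x = hess x d (0, v.2) - hess x d (v.1, 0).
  by rewrite deriveB//; exact: diff_derivable.
rewrite /h !derive_gradx// !derive_grady// gx0 gy0.
have d0 n (a : 'rV[R]_n) : dotv 0 a = 0 by rewrite -(scale0r 0) dotvZl mul0r.
rewrite !d0 subr0 subr0; move: (hessC x) (hessDl x) (hess_xx_bounds x).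
move: (hess_yy_bounds x) (hess_xy_bound x); move: (hess x) => H Hyy Hxy HC HD Hxx hE.
pose A u u' := H (u, 0) (u', 0).
pose B u u' := H (u, 0) (0, u').
(* Strong concavity in [y] makes this block negative; the sign turns it into a form with positive
   bounds, like [A]. *)
pose C u u' := - H (0, u) (0, u').
have px u u' : (u + u', 0) = (u, 0) + (u', 0) :> 'rV[R]_dx * 'rV[R]_dy.
  by rewrite -[RHS]/(u + u', 0 + 0) addr0.
have py u u' : (0, u + u') = (0, u) + (0, u') :> 'rV[R]_dx * 'rV[R]_dy.
  by rewrite -[RHS]/(0 + 0, u + u') addr0.
have dE : d = (d.1, 0) + (0, d.2).
  by rewrite -[RHS]/(d.1 + 0, 0 + d.2) addr0 add0r; case: (d).
have := @saddle_form_bound R dx dy alpha beta eta kappa k rho mux muy Lx Ly Lxy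
  al0 be0 Lxy0 ek0 amu bmu aL bL abL rate A B C.
move=> /(_ _ _ _ _ _ _ _ _ _ d.1 v.1 d.2 v.2) S.
have {S} : dotv d.1 v.1 / alpha + dotv d.2 v.2 / beta - A d.1 v.1 - C d.2 v.2
   + B d.1 v.2 - B v.1 d.2 <= rho / 2 *
     (wnorm2 alpha beta d.1 d.2 + wnorm2 alpha beta v.1 v.2).
  apply: S => [u u'|u u' y|u u'|u u' y|u u' y|y u u'|u|u|u u'].
  - exact: HC.
  - by rewrite /A px HD.
  - by rewrite /C HC.
  - by rewrite /C py HD opprD.
  - by rewrite /B px HD.
  - by rewrite /B !(HC (y, 0)) py HD.
  - exact: Hxx.
  - exact: Hyy.
  - exact: Hxy.
apply: le_trans; rewrite le_eqVlt; apply/orP; left; apply/eqP.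
have -> : w.1 = d.1 - alpha *: gradx f z by rewrite /w /d /= addrAC.
have -> : w.2 = d.2 + beta *: grady f z by rewrite /w /d /= addrAC.
rewrite (dotvBl d.1) (dotvDl d.2) !dotvZl.
have HL : H d (0, v.2) = B d.1 v.2 - C d.2 v.2 by rewrite [in LHS]dE HD /C opprK.
have HR : H d (v.1, 0) = A d.1 v.1 + B v.1 d.2.
  by rewrite [in LHS]dE HD (HC (0, d.2)).
have -> : dotv (gradx f z) v.1 = dotv (grady f z) v.2
  - (- C d.2 v.2 + B d.1 v.2 - (A d.1 v.1 + B v.1 d.2)) by lra.
by field; rewrite !gt_eqF.
Qed.

Lemma sim_gda_contraction z : psi_sim alpha beta zs (sim_gda_step alpha beta f z)
  <= rho ^+ 2 * psi_sim alpha beta zs z.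
Proof.
have psiE z' : psi_sim alpha beta zs z' = wnorm2 alpha beta (z' - zs).1 (z' - zs).2.
  by rewrite /psi_sim /wnorm2 !sqr_enorm !div1r ![_^-1 * _]mulrC.
rewrite !psiE; have := sim_gda_step_form z.
set w := _ - zs; set d := z - zs => /= H.
set Nw := wnorm2 _ _ w.1 w.2; set Nd := wnorm2 _ _ d.1 d.2.
have {}H (s : R) : s * Nw <= rho / 2 * (Nd + s ^+ 2 * Nw).
  have := H (s *: w.1, s *: w.2); rewrite /= !dotvZr.
  have -> : wnorm2 alpha beta (s *: w.1) (s *: w.2) = s ^+ 2 * Nw.
    by rewrite /Nw /wnorm2 !dotvZl !dotvZr; ring.
  by apply: le_trans; rewrite /Nw /wnorm2 mulrDr !mulrA.
(* The factor [rho] may vanish, as for condition number 1 without coupling; then [s = 1] suffices.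
   Otherwise [s = rho^-1] is the optimal scaling. *)
have [r0|r0] := eqVneq rho 0.
  by have := H 1; rewrite r0 expr0n /= !mul0r mul1r.
have := H rho^-1.
have rp : 0 < rho by rewrite lt_neqAle eq_sym r0.
rewrite -(ler_pM2l (mulr_gt0 rp rp)).
have -> : rho * rho * (rho^-1 * Nw) = rho * Nw by field.
have -> : rho * rho * (rho / 2 * (Nd + rho^-1 ^+ 2 * Nw)) =
  rho * ((rho ^+ 2 * Nd + Nw) / 2) by field.
rewrite ler_pM2l//; lra.
Qed.

End SaddleFunction.

(** * Choice of the two step sizes and conclusion *)

Theorem theorem3p1 (R : realType) :
  exists c1 c2 : R, 0 < c1 /\ c1 <= c2 /\
  forall (mux muy Lx Ly Lxy : R),
    0 < mux -> mux <= Lx -> 0 < muy -> muy <= Ly -> 0 <= Lxy ->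
  forall (dx dy : nat) (f : 'rV[R]_dx * 'rV[R]_dy -> R),
    in_class mux muy Lx Ly Lxy f ->
  forall zs : 'rV[R]_dx * 'rV[R]_dy, nash_equilibrium f zs ->
  let kx := Lx / mux in
  let ky := Ly / muy in
  let kxy := Lxy / Num.sqrt (mux * muy) in
  exists alpha beta : R,
    0 < alpha /\ 0 < beta /\
    alpha * mux = beta * muy /\
    c1 / (kx + ky + kxy ^+ 2) <= alpha * mux /\
    alpha * mux <= c2 / (kx + ky + kxy ^+ 2) /\
    forall (z0 : 'rV[R]_dx * 'rV[R]_dy) (k : nat),
      psi_sim alpha beta zs (sim_gda alpha beta f z0 k.+1)
        <= sim_gda_rate kx ky kxy
             * psi_sim alpha beta zs (sim_gda alpha beta f z0 k).
Proof.
exists (2 / 5), 8; split; first lra; split; first lra.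
move=> mux muy Lx Ly Lxy mux0 muxL muy0 muyL Lxy0 dx dy f fc zs nash kx ky kxy.
have kx1 : 1 <= kx by rewrite ler_pdivlMr// mul1r.
have ky1 : 1 <= ky by rewrite ler_pdivlMr// mul1r.
have kxy0 : 0 <= kxy by rewrite divr_ge0// sqrtr_ge0.
have k2 := sqr_ge0 kxy.
have K1 : 1 <= Num.max kx ky by rewrite le_max kx1.
have [Kx Ky] : kx <= Num.max kx ky /\ ky <= Num.max kx ky.
  by rewrite !le_max !lexx orbT.
have KS : Num.max kx ky <= kx + ky by rewrite ge_max; apply/andP; split; lra.
have [eta [eta0 lo up rho0 rate]] := step_size_exists K1 kxy0.
have amu : eta / mux * mux = eta by rewrite divfK// gt_eqF.
have bmu : eta / muy * muy = eta by rewrite divfK// gt_eqF.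
(* These make both [alpha * mux] and [beta * muy] equal to the single parameter [eta]. *)
exists (eta / mux), (eta / muy); split; first exact: divr_gt0.
split; first exact: divr_gt0.
rewrite amu bmu; split=> //; split; first by apply: lo; lra.
split; first by apply: up; lra.
(* Iterate [j.+1] unfolds to one step from iterate [j], and [sim_gda_rate] to the square of
   [rho]. *)
move=> z0 j; apply: (sim_gda_contraction (class_diff2 fc) mux0 muxL muy0 muyL Lxy0 fc
  nash (eta := eta) (kappa := Num.max kx ky) (k := kxy)) => //.
- exact: divr_gt0.
- exact: divr_gt0.
- by rewrite mulr_ge0// ltW.
- by rewrite mulrAC -mulrA ler_wpM2l// ltW.
- by rewrite mulrAC -mulrA ler_wpM2l// ltW.
have sE : Num.sqrt (mux * muy) ^+ 2 = mux * muy.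
  by rewrite sqr_sqrtr// mulr_ge0// ltW.
(* The coupling condition holds with equality, by the definition of [kxy]. *)
rewrite le_eqVlt; apply/orP; left; apply/eqP.
rewrite exprMn /kxy exprMn exprVn sE.
by field; rewrite !gt_eqF.
Qed.
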